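(* Let $f,g:B_R\to\mathbb{O}$ be regular functions. Then $N(f\ast g)=N(f)\,N(g)$.
   Context: $\mathbb{O}$ is the real alternative division algebra of octonions, $\overline{x}$ is octonionic conjugation. $B_R$ is the open ball of $\mathbb{O}$ centered at the origin with radius $R\in(0,+\infty]$. A function $f:B_R\to\mathbb{O}$ is (slice) regular if it is given by a power series $f(w)=\sum_{i\ge 0} w^i a_i$ with coefficients $a_i\in\mathbb{O}$ on the right, converging in $B_R$. For regular $f=\sum_i w^ia_i$, $g=\sum_j w^jb_j$ on $B_R$, the product is the regular function $(f\ast g)(w)=\sum_k w^k\big(\sum_{i+j=k}a_ib_j\big)$; when $f$ has real coefficients one writes $fg$ for $f\ast g$. Put $\overline{f}(w)=\sum_i w^i\overline{a}_i$. The normal series of $f$ is $N(f):=f\ast\overline f=\overline f\ast f$; it is regular on $B_R$ and has real coefficients. *)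

(* Defs.v *)
From HB Require Import structures.
From mathcomp Require Import all_boot all_order all_algebra.
From mathcomp Require Import all_classical all_reals all_analysis.
Set Implicit Arguments.
Unset Strict Implicit.
Unset Printing Implicit Defensive.
Import Order.TTheory GRing.Theory Num.Theory.
Import numFieldNormedType.Exports.
Local Open Scope classical_set_scope.
Local Open Scope ring_scope.

(* The Cayley-Dickson doubling of an algebra [A] with involution, starting from
   the reals with the identity involution:
     (a, b) (c, d) = (a c - d^* b, d a + b c^* )   and   (a, b)^* = (a^*, - b). *)
Definition cd_conj (A : zmodType) (conj : A -> A) (x : A * A) : A * A :=
  (conj x.1, - x.2).

Definition cd_mul (A : zmodType) (conj : A -> A) (mul : A -> A -> A)
    (x y : A * A) : A * A :=
  (mul x.1 y.1 - mul (conj y.2) x.2, mul y.2 x.1 + mul x.2 (conj y.1)).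

Definition complex (R : realType) : Type := (R^o * R^o)%type.
HB.instance Definition _ (R : realType) :=
  NormedModule.copy (complex R) (R^o * R^o)%type.

Definition quaternion (R : realType) : Type := (complex R * complex R)%type.
HB.instance Definition _ (R : realType) :=
  NormedModule.copy (quaternion R) (complex R * complex R)%type.

(* The library norm [`|x|] inherited here is the maximum of the coordinates: it
   is used only for its (product) topology.  The Euclidean norm is [onorm]. *)
Definition octonion (R : realType) : Type := (quaternion R * quaternion R)%type.
HB.instance Definition _ (R : realType) :=
  NormedModule.copy (octonion R) (quaternion R * quaternion R)%type.

Definition cconj (R : realType) : complex R -> complex R :=
  @cd_conj R (fun x => x).
Definition cmul (R : realType) : complex R -> complex R -> complex R :=
  @cd_mul R (fun x => x) (fun x y => x * y).

Definition qconj (R : realType) : quaternion R -> quaternion R :=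
  cd_conj (@cconj R).
Definition qmul (R : realType) : quaternion R -> quaternion R -> quaternion R :=
  cd_mul (@cconj R) (@cmul R).

Definition oconj (R : realType) : octonion R -> octonion R :=
  cd_conj (@qconj R).
Definition omul (R : realType) : octonion R -> octonion R -> octonion R :=
  cd_mul (@qconj R) (@qmul R).

Definition oreal (R : realType) (t : R) : octonion R :=
  (((t, 0), (0, 0)), ((0, 0), (0, 0))).

Definition opow (R : realType) (w : octonion R) (n : nat) : octonion R :=
  iter n (omul w) (oreal 1).

Definition cnormsq (R : realType) (x : complex R) : R := x.1 ^+ 2 + x.2 ^+ 2.
Definition qnormsq (R : realType) (x : quaternion R) : R :=
  cnormsq x.1 + cnormsq x.2.
Definition onorm (R : realType) (x : octonion R) : R :=
  Num.sqrt (qnormsq x.1 + qnormsq x.2).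

Definition oball (R : realType) (rho : \bar R) : set (octonion R) :=
  [set w | ((onorm w)%:E < rho)%E].

Definition oseries (R : realType) (a : nat -> octonion R) (w : octonion R) :
    nat -> octonion R :=
  series (fun i => omul (opow w i) (a i)).

(* A function on [oball rho] is represented by a total function whose values
   outside of the ball are irrelevant. *)
Definition is_expansion (R : realType) (rho : \bar R) (a : nat -> octonion R)
    (f : octonion R -> octonion R) : Prop :=
  forall w, oball rho w -> oseries a w @ \oo --> f w.

Definition regular (R : realType) (rho : \bar R)
    (f : octonion R -> octonion R) : Prop :=
  exists a, is_expansion rho a f.

(* The coefficients of a regular function are unique as soon as [0 < rho]; the
   default value is taken only if [f] is not regular. *)
Definition coefs (R : realType) (rho : \bar R)
    (f : octonion R -> octonion R) : nat -> octonion R :=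
  xget (fun=> 0) [set a | is_expansion rho a f].

(* A total function: [limn] is a genuine sum only where the series converges,
   which is the case on [oball rho] for all the coefficient sequences below,
   provided [f] and [g] are regular and [0 < rho]. *)
Definition power_sum (R : realType) (a : nat -> octonion R) :
    octonion R -> octonion R :=
  fun w => limn (oseries a w).

Definition star (R : realType) (rho : \bar R)
    (f g : octonion R -> octonion R) : octonion R -> octonion R :=
  power_sum (fun k => \sum_(i < k.+1) omul (coefs rho f i) (coefs rho g (k - i)%N)).

Definition conj_series (R : realType) (rho : \bar R)
    (f : octonion R -> octonion R) : octonion R -> octonion R :=
  power_sum (fun i => oconj (coefs rho f i)).

Definition normal_series (R : realType) (rho : \bar R)
    (f : octonion R -> octonion R) : octonion R -> octonion R :=
  star rho f (conj_series rho f).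

(* Main.v *)
(* A power series converging on the ball satisfies |a_i| r^i = O(1) for every
   radius r < rho. This growth condition is stable under the Cauchy product and
   conjugation, and it ensures convergence on the whole ball; together with the
   uniqueness of coefficients (seen on the real axis), it reduces the claim to an
   identity between coefficient sequences. Order by order, that identity is the
   multiplicativity of the norm of octonions over the commutative ring of
   polynomials, i.e. Degen's eight-square identity. *)

Require Import Defs.
From HB Require Import structures.
From mathcomp Require Import all_boot all_order all_algebra.
From mathcomp Require Import all_classical all_reals all_analysis.
From mathcomp Require Import ring lra.
Set Implicit Arguments.
Unset Strict Implicit.
Unset Printing Implicit Defensive.
Import Order.TTheory GRing.Theory Num.Theory.
Import numFieldNormedType.Exports.
Local Open Scope classical_set_scope.
Local Open Scope ring_scope.

(** * Octonions over a commutative ring *)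

(* For [A := R], [oct_mul] and [oct_conj] are convertible to [omul] and [oconj]. *)
Definition oct_over (A : comNzRingType) : zmodType :=
  (((A * A) * (A * A)) * ((A * A) * (A * A)))%type.

Definition oct_conj (A : comNzRingType) : oct_over A -> oct_over A :=
  cd_conj (cd_conj (cd_conj (fun x : A => x))).

Definition oct_mul (A : comNzRingType) : oct_over A -> oct_over A -> oct_over A :=
  cd_mul (cd_conj (cd_conj (fun x : A => x)))
    (cd_mul (cd_conj (fun x : A => x))
      (cd_mul (fun x : A => x) (fun x y : A => x * y))).

Definition oct_scalar (A : comNzRingType) (t : A) : oct_over A :=
  (((t, 0), (0, 0)), ((0, 0), (0, 0))).

Definition oct_normsq (A : comNzRingType) (x : oct_over A) : A :=
  (x.1.1.1 ^+ 2 + x.1.1.2 ^+ 2 + (x.1.2.1 ^+ 2 + x.1.2.2 ^+ 2)) +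
  (x.2.1.1 ^+ 2 + x.2.1.2 ^+ 2 + (x.2.2.1 ^+ 2 + x.2.2.2 ^+ 2)).

Lemma oct_mul_conj (A : comNzRingType) (x : oct_over A) :
  oct_mul x (oct_conj x) = oct_scalar (oct_normsq x).
Proof.
case: x => [[[x0 x1] [x2 x3]] [[x4 x5] [x6 x7]]].
rewrite /oct_mul /oct_conj /oct_scalar /oct_normsq /cd_mul /cd_conj /=.
congr (((_, _), (_, _)), ((_, _), (_, _))) => /=; ring.
Qed.

Lemma oct_mul_scalar (A : comNzRingType) (s t : A) :
  oct_mul (oct_scalar s) (oct_scalar t) = oct_scalar (s * t).
Proof.
rewrite /oct_mul /oct_scalar /cd_mul /cd_conj /=.
congr (((_, _), (_, _)), ((_, _), (_, _))) => /=; ring.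
Qed.

(** Degen's eight-square identity, a polynomial identity in sixteen variables. It serves over the
    reals, for [onorm], and over [{poly A}], for power series. *)
Lemma oct_normsqM (A : comNzRingType) (x y : oct_over A) :
  oct_normsq (oct_mul x y) = oct_normsq x * oct_normsq y.
Proof.
case: x => [[[x0 x1] [x2 x3]] [[x4 x5] [x6 x7]]].
case: y => [[[y0 y1] [y2 y3]] [[y4 y5] [y6 y7]]].
rewrite /oct_mul /oct_normsq /cd_mul /cd_conj /=; ring.
Qed.

Lemma oct_mul_conjM (A : comNzRingType) (x y : oct_over A) :
  let N z := oct_mul z (oct_conj z) in
  N (oct_mul x y) = oct_mul (N x) (N y).
Proof. by rewrite /= !oct_mul_conj oct_normsqM oct_mul_scalar. Qed.

(** * Cauchy products and Cayley-Dickson doubling *)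

Definition conv (V : zmodType) (mul : V -> V -> V) (a b : nat -> V) (k : nat) : V :=
  \sum_(i < k.+1) mul (a i) (b (k - i)%N).

(** In the model case [V] consists of polynomials over [W], and [c k] reads off the coefficient of
    order [k]. *)
Definition is_cauchy_coef (V W : zmodType) (mulV : V -> V -> V) (mulW : W -> W -> W)
    (c : nat -> V -> W) : Prop :=
  forall k x y, c k (mulV x y) = conv mulW (c ^~ x) (c ^~ y) k.

Section CayleyDicksonCoefficients.
Variables (V W : zmodType) (conjV : V -> V) (mulV : V -> V -> V).
Variables (conjW : W -> W) (mulW : W -> W -> W) (c : nat -> V -> W).
Hypothesis coefB : forall k x y, c k (x - y) = c k x - c k y.
Hypothesis coef_conj : forall k x, c k (conjV x) = conjW (c k x).

Definition cd_coef (k : nat) (x : V * V) : W * W := (c k x.1, c k x.2).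

Lemma cd_coefB k x y : cd_coef k (x - y) = cd_coef k x - cd_coef k y.
Proof. by rewrite /cd_coef /= !coefB. Qed.

Lemma cd_coef_conj k x :
  cd_coef k (cd_conj conjV x) = cd_conj conjW (cd_coef k x).
Proof.
rewrite /cd_coef /cd_conj /= coef_conj; congr pair.
(* Only subtraction is assumed to commute with [c k], so the opposite is read as [0 - x.2] and [0]
   as [0 - 0]. *)
by rewrite -[- x.2]sub0r -[0 in LHS](subrr 0) !coefB subrr sub0r.
Qed.

(** In two of the four products of the doubling formula the factor from [y] stands first; their
    convolutions are reversed by [i -> k - i] before being combined termwise with the others. *)
Lemma cd_coefM : is_cauchy_coef mulV mulW c ->
  is_cauchy_coef (cd_mul conjV mulV) (cd_mul conjW mulW) cd_coef.
Proof.
move=> coefM k x y.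
have coefD u v : c k (u + v) = c k u + c k v.
  by rewrite -{1}[v]opprK -[- v]sub0r !coefB -{1}(subrr 0) coefB subrr sub0r opprK.
have rev u v : conv mulW u v k = \sum_(i < k.+1) mulW (u (k - i)%N) (v i).
  rewrite /conv (reindex_inj rev_ord_inj) /=; apply: eq_bigr => i _.
  by rewrite subSS subKn // -ltnS.
have sum_pair (F : 'I_k.+1 -> W * W) :
    \sum_i F i = (\sum_i (F i).1, \sum_i (F i).2).
  by apply: injective_projections => /=;
    [apply: (big_morph fst)|apply: (big_morph snd)].
rewrite {1}/conv sum_pair; congr pair => /=.
- rewrite coefB !coefM [X in _ - X]rev /conv sumrB.
  by congr (_ - _); apply: eq_bigr => i _; rewrite coef_conj.
- rewrite coefD !coefM [X in X + _]rev /conv big_split.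
  by congr (_ + _); apply: eq_bigr => i _; rewrite coef_conj.
Qed.
End CayleyDicksonCoefficients.

(** * The norm of octonionic formal power series *)

Section FormalPowerSeries.
Variable A : comNzRingType.

Definition oct_coef : nat -> oct_over {poly A} -> oct_over A :=
  cd_coef (cd_coef (cd_coef (fun k (p : {poly A}) => p`_k))).

Lemma oct_coef_conj k x : oct_coef k (oct_conj x) = oct_conj (oct_coef k x).
Proof.
apply: cd_coef_conj => [*|j y]; first by do 2 apply: cd_coefB => *; exact: coefB.
apply: cd_coef_conj => [*|i z]; first by apply: cd_coefB => *; exact: coefB.
by apply: cd_coef_conj => // *; exact: coefB.
Qed.

Lemma oct_coefM : is_cauchy_coef (@oct_mul {poly A}) (@oct_mul A) oct_coef.
Proof.
have coef0M : is_cauchy_coef (fun x y : {poly A} => x * y) (fun x y : A => x * y)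
  (fun k (p : {poly A}) => p`_k) by move=> k x y; exact: coefM.
apply: cd_coefM => [*|*|].
- by do 2 apply: cd_coefB => *; exact: coefB.
- apply: cd_coef_conj => *; first by apply: cd_coefB => *; exact: coefB.
  by apply: cd_coef_conj => // *; exact: coefB.
apply: cd_coefM => [*|*|].
- by apply: cd_coefB => *; exact: coefB.
- by apply: cd_coef_conj => // *; exact: coefB.
by apply: cd_coefM => // *; exact: coefB.
Qed.

(** Truncating a sequence turns it into an octonion over the commutative ring [{poly A}], where the
    norm identity is available. *)
Definition oct_poly (n : nat) (a : nat -> oct_over A) : oct_over {poly A} :=
  let p (pr : oct_over A -> A) := \poly_(i < n) pr (a i) in
  (((p (fun x => x.1.1.1), p (fun x => x.1.1.2)),
    (p (fun x => x.1.2.1), p (fun x => x.1.2.2))),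
   ((p (fun x => x.2.1.1), p (fun x => x.2.1.2)),
    (p (fun x => x.2.2.1), p (fun x => x.2.2.2)))).

Lemma oct_coef_poly n a k : (k < n)%N -> oct_coef k (oct_poly n a) = a k.
Proof.
move=> kn; rewrite /oct_coef /oct_poly /cd_coef /= !coef_poly kn.
by case: (a k) => [[[? ?] [? ?]] [[? ?] [? ?]]].
Qed.

(** This locality allows sequences to be replaced by their truncations. *)
Lemma conv_local (a a' b b' : nat -> oct_over A) k :
  (forall i, (i <= k)%N -> a i = a' i) -> (forall i, (i <= k)%N -> b i = b' i) ->
  conv (@oct_mul A) a b k = conv (@oct_mul A) a' b' k.
Proof.
move=> aa' bb'; apply: eq_bigr => i _.
by rewrite aa' ?bb' ?leq_subr // -ltnS.
Qed.

(* Up to order [k], the sequences [a] and [b] are the coefficients of octonions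
   over the polynomial ring, where the norm is multiplicative. *)
Lemma conv_normM (a b : nat -> oct_over A) :
  let cv := conv (@oct_mul A) in
  let N u := cv u (fun i => oct_conj (u i)) in
  N (cv a b) = cv (N a) (N b).
Proof.
move=> cv N; apply: funext => k.
pose coefs_upto u x := forall i, (i <= k)%N -> u i = oct_coef i x.
have cvP u v x y : coefs_upto u x -> coefs_upto v y ->
    coefs_upto (cv u v) (oct_mul x y).
  move=> ux vy i ik; rewrite oct_coefM.
  by apply: conv_local => j ji; [apply: ux|apply: vy]; exact: leq_trans ik.
have NP u x : coefs_upto u x -> coefs_upto (N u) (oct_mul x (oct_conj x)).
  by move=> ux; apply: cvP => // i ik; rewrite oct_coef_conj ux.
(* Truncating below [k.+1] keeps order [k] itself. *)
have polyP u : coefs_upto u (oct_poly k.+1 u) by move=> i ik; rewrite oct_coef_poly.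
rewrite (NP _ _ (cvP _ _ _ _ (polyP a) (polyP b))) // oct_mul_conjM.
by rewrite -(cvP _ _ _ _ (NP _ _ (polyP a)) (NP _ _ (polyP b))).
Qed.
End FormalPowerSeries.

(** * The Euclidean norm against the maximum norm *)

Section OctonionNorms.
Variable R : realType.
Implicit Types x y w : octonion R.

Lemma omul_real (t : R) x : omul (oreal t) x = t *: x.
Proof.
case: x => [[[x0 x1] [x2 x3]] [[x4 x5] [x6 x7]]].
have -> : t *: ((((x0, x1), (x2, x3)), ((x4, x5), (x6, x7))) : octonion R) =
   (((t * x0, t * x1), (t * x2, t * x3)), ((t * x4, t * x5), (t * x6, t * x7))) by [].
change (oct_mul (oct_scalar t) (((x0, x1), (x2, x3)), ((x4, x5), (x6, x7))) =
  (((t * x0, t * x1), (t * x2, t * x3)), ((t * x4, t * x5), (t * x6, t * x7)))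
  :> oct_over R).
rewrite /oct_mul /oct_scalar /cd_mul /cd_conj /=.
congr (((_, _), (_, _)), ((_, _), (_, _))) => /=; ring.
Qed.

Lemma opow_real (t : R) n : opow (oreal t) n = oreal (t ^+ n).
Proof.
by elim: n => //= n ->; rewrite exprS; exact: oct_mul_scalar.
Qed.

Lemma onormE x : onorm x = Num.sqrt (oct_normsq (x : oct_over R)).
Proof. by []. Qed.

Lemma oct_normsq_ge0 (x : oct_over R) : 0 <= oct_normsq x.
Proof. by rewrite !addr_ge0 ?sqr_ge0. Qed.

Lemma onormM x y : onorm (omul x y) = onorm x * onorm y.
Proof. by rewrite !onormE -sqrtrM ?oct_normsq_ge0 // -oct_normsqM. Qed.

Lemma onorm_ge0 x : 0 <= onorm x. Proof. exact: sqrtr_ge0. Qed.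

Lemma onorm_conj x : onorm (oconj x) = onorm x.
Proof.
by rewrite !onormE /oct_normsq /= !sqrrN.
Qed.

Lemma onorm_real (t : R) : onorm (oreal t) = `|t|.
Proof. by rewrite onormE /oct_normsq /= expr0n /= !addr0 sqrtr_sqr. Qed.

Lemma onorm_pow w n : onorm (opow w n) = onorm w ^+ n.
Proof.
elim: n => [|n IH]; first by rewrite onorm_real normr1.
by rewrite /= onormM IH exprS.
Qed.

(** Together with [onorm_le_norm], this transfers estimates between the multiplicative norm and the
    one that governs convergence. *)
Lemma norm_le_onorm x : `|x| <= onorm x.
Proof.
case: x => [[[x0 x1] [x2 x3]] [[x4 x5] [x6 x7]]].
have le_sqrt (t s : R) : t ^+ 2 <= s -> `|t| <= Num.sqrt s.
  by move=> ts; rewrite -sqrtr_sqr ler_wsqrtr.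
rewrite onormE !prod_normE /= !ge_max /oct_normsq /=.
have := (sqr_ge0 x0, sqr_ge0 x1, sqr_ge0 x2, sqr_ge0 x3).
have := (sqr_ge0 x4, sqr_ge0 x5, sqr_ge0 x6, sqr_ge0 x7).
move=> [[[h4 h5] h6] h7] [[[h0 h1] h2] h3].
by do ![apply/andP; split]; apply: le_sqrt; lra.
Qed.

(** Eight squares, each at most the squared maximum, add up to less than 3 ^ 2 = 9 times it, or to
    0. *)
Lemma onorm_le_norm x : onorm x <= 3 * `|x|.
Proof.
rewrite -[leRHS]ger0_norm ?mulr_ge0 // -sqrtr_sqr ler_wsqrtr // exprMn.
have le_sqr (M t : R) : 0 <= M -> `|t| <= M -> t ^+ 2 <= M ^+ 2.
  by move=> M0 tM; rewrite -real_normK ?num_real // ler_sqr ?nnegrE.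
have : `|x| <= `|x| by [].
have : 0 <= `|x| by [].
(* The one occurrence of the norm left in place unfolds into eight coordinate bounds by [M]. *)
move: {1 3 4}`|x| => M M0.
case: x => [[[x0 x1] [x2 x3]] [[x4 x5] [x6 x7]]].
rewrite !prod_normE /= !ge_max => /andP[/andP[/andP[h0 h1] /andP[h2 h3]]].
move=> /andP[/andP[h4 h5] /andP[h6 h7]].
have := le_sqr _ _ M0 h0; have := le_sqr _ _ M0 h1; have := le_sqr _ _ M0 h2;
have := le_sqr _ _ M0 h3.
have := le_sqr _ _ M0 h4; have := le_sqr _ _ M0 h5.
have := le_sqr _ _ M0 h6; have := le_sqr _ _ M0 h7.
rewrite /qnormsq /cnormsq /=; have := sqr_ge0 M; lra.
Qed.
End OctonionNorms.

(** * Geometric bounds, convergence and the identity principle *)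

Lemma geometric_tail_le (R : realFieldType) (q : R) m n : 0 <= q -> q < 1 ->
  \sum_(m <= i < n) q ^+ i <= q ^+ m / (1 - q).
Proof.
move=> q0 q1; rewrite ler_pdivlMr ?subr_gt0 // mulr_suml.
have [mn|/ltnW nm] := leqP m n; last by rewrite big_geq // exprn_ge0.
(* After multiplication by [1 - q] the sum telescopes. *)
rewrite (eq_bigr (fun i => - (q ^+ i.+1 - q ^+ i))); last first.
  by move=> i _; rewrite exprS; ring.
by rewrite sumrN telescope_sumr // opprB lerBlDr lerDl exprn_ge0.
Qed.

Section NormedPowerSeries.
Variable R : realType.

(** The form of completeness used for convergence; being stable under products, it climbs from the
    reals to the octonions in three doublings. *)
Definition geometrically_complete (V : normedModType R) : Prop :=
  forall (u : nat -> V) (M q : R), 0 <= q -> q < 1 ->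
    (forall n, `|u n| <= M * q ^+ n) -> cvgn (series u).

Lemma geometrically_complete_real : geometrically_complete R^o.
Proof.
move=> u M q q0 q1 uM; apply: normed_cvg.
have M0 : 0 <= M by have := le_trans (normr_ge0 _) (uM 0%N); rewrite expr0 mulr1.
apply: series_le_cvg (is_cvg_geometric_series (a := M) (z := q) _) => //=.
- by move=> n; rewrite mulr_ge0 // exprn_ge0.
- by rewrite ger0_norm.
Qed.

Lemma geometrically_complete_prod (U V : normedModType R) :
  geometrically_complete U -> geometrically_complete V ->
  geometrically_complete (U * V)%type.
Proof.
move=> cU cV u M q q0 q1 uM.
have c1 : cvgn (series (fun n => (u n).1)).
  apply: (cU _ M q) => // n; apply: le_trans (uM n).
  by rewrite prod_normE le_max lexx.
have c2 : cvgn (series (fun n => (u n).2)).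
  apply: (cV _ M q) => // n; apply: le_trans (uM n).
  by rewrite prod_normE le_max lexx orbT.
have -> : series u =
    fun n => (series (fun n => (u n).1) n, series (fun n => (u n).2) n).
  apply: funext => n; rewrite /series /=.
  by apply: injective_projections => /=;
    [apply: (big_morph fst)|apply: (big_morph snd)].
apply/cvg_ex; exists ((limn (series (fun n => (u n).1)),
  limn (series (fun n => (u n).2))) : (U * V)%type).
exact: cvg_pair.
Qed.

(** By strong induction the terms below order [n] vanish, so the term of order [n] is balanced by a
    tail of size O(t ^ n.+1). Dividing by [t ^+ n] and letting [t] tend to 0 kills [c n]. *)
Lemma power_series_eq0 (V : normedModType R) (c : nat -> V) (r M : R) : 0 < r ->
  (forall i, `|c i| * r ^+ i <= M) ->
  (forall t, 0 < t -> t < r -> series (fun i => t ^+ i *: c i) @ \oo --> 0) ->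
  forall n, c n = 0.
Proof.
move=> r0 cM c0; elim/ltn_ind => n IH.
have M0 : 0 <= M by apply: le_trans (cM 0%N); rewrite expr0 mulr1.
(* The factor 2 bounds [1 / (1 - t / r)], as [t / r] is at most one half. *)
have small t : 0 < t -> t <= r / 2 -> `|c n| <= 2 * M / r ^+ n.+1 * t.
  move=> t0 tr; have q0 : 0 <= t / r by rewrite divr_ge0 // ltW.
  have q12 : t / r <= 2^-1 by rewrite ler_pdivrMr // mulrC.
  suff : `|t ^+ n *: c n| <= M * ((t / r) ^+ n.+1 / (1 - t / r)).
    move=> h; rewrite -(ler_pM2l (exprn_gt0 n t0)).
    apply: (@le_trans _ _ (M * ((t / r) ^+ n.+1 * 2))).
      rewrite normrZ ger0_norm ?exprn_ge0 ?(ltW t0) // in h.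
      apply: le_trans h _; rewrite ler_wpM2l // ler_wpM2l ?exprn_ge0 //.
      rewrite invf_ple ?posrE; lra.
    rewrite le_eqVlt; apply/orP; left; apply/eqP.
    by rewrite exprMn exprVn [t ^+ n.+1]exprS; field; rewrite expf_neq0 // gt_eqF.
  apply/ler_addgt0Pr => e e0.
  have tr' : t < r by apply: le_lt_trans tr _; lra.
  (* The index [N + n.+1] is past [N] and also past order [n], so this partial sum splits into the
     term of order [n] and a tail [T]. *)
  have /cvgrPdist_le/(_ _ e0)[N _ /(_ (N + n.+1)%N (leq_addr _ _))] := c0 _ t0 tr'.
  rewrite /= sub0r normrN /series /=.
  rewrite (big_cat_nat (n := n.+1)) ?leq_addl //= big_nat_recr //=.
  rewrite big_nat_cond big1 ?add0r; last first.
    by move=> i /andP[/andP[_ i_n] _]; rewrite IH ?scaler0.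
  set T := \sum_(_ <= i < _) _ => hS.
  have hT : `|T| <= M * ((t / r) ^+ n.+1 / (1 - t / r)).
    apply: (@le_trans _ _ (M * \sum_(n.+1 <= i < N + n.+1) (t / r) ^+ i)).
      rewrite mulr_sumr; apply: le_trans (ler_norm_sum _ _ _) _.
      apply: ler_sum => i _; rewrite normrZ ger0_norm ?exprn_ge0 ?(ltW t0) //.
      rewrite exprMn exprVn mulrA ler_pdivlMr ?exprn_gt0 //.
      rewrite -mulrA [leRHS]mulrC ler_wpM2l ?exprn_ge0 ?(ltW t0) //.
    by rewrite ler_wpM2l // geometric_tail_le //; lra.
  rewrite -[t ^+ n *: c n](addrK T).
  by apply: le_trans (ler_normB _ _) _; rewrite addrC lerD.
apply/eqP; rewrite -normr_le0; apply/ler_addgt0Pr => e e0; rewrite add0r.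
pose K := 2 * M / r ^+ n.+1.
have K0 : 0 <= K by rewrite divr_ge0 ?mulr_ge0 ?exprn_ge0 // ltW.
(* This makes [K * t] at most [e]; the denominator [K + 1] stays positive even if [K] is 0. *)
pose t := Num.min (r / 2) (e / (K + 1)).
have t0 : 0 < t by rewrite lt_min !divr_gt0 // ltr_wpDl.
apply: le_trans (small t t0 _) _; first by rewrite ge_min lexx.
apply: (@le_trans _ _ (K * (e / (K + 1)))).
  by rewrite ler_wpM2l // ge_min lexx orbT.
by rewrite mulrA ler_pdivrMr ?ltr_wpDl // mulrC ler_wpM2l ?ltW // ltrDl.
Qed.
End NormedPowerSeries.

(** * Regular functions and their coefficients *)

Section RegularFunctions.
Variables (R : realType) (rho : \bar R).
Implicit Types (a b : nat -> octonion R) (f : octonion R -> octonion R).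

Lemma radius_between (t : R) : (t%:E < rho)%E -> exists2 r : R, t < r & (r%:E < rho)%E.
Proof.
case: rho => [s||//]; last by exists (t + 1); rewrite ?ltrDl ?ltry.
by rewrite lte_fin => ts; exists ((t + s) / 2); rewrite ?lte_fin; lra.
Qed.

Definition geometric_growth a : Prop :=
  forall r : R, 0 < r -> (r%:E < rho)%E -> exists M, forall i, `|a i| * r ^+ i <= M.

Lemma oseries_real a (t : R) :
  oseries a (oreal t) = series (fun i => t ^+ i *: a i).
Proof.
by apply: funext => n; apply: eq_bigr => i _; rewrite opow_real omul_real.
Qed.

(** At the real point [r] the series converges, so its terms tend to 0 and are bounded. *)
Lemma is_expansion_growth a f : is_expansion rho a f -> geometric_growth a.
Proof.
move=> af r r0 rrho.
have /af : oball rho (oreal r) by rewrite /oball /= onorm_real gtr0_norm.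
rewrite oseries_real => /cvgP/cvg_series_cvg_0/cvgP/cvg_seq_bounded.
move=> /pinfty_ex_gt0[M _ /= aM]; exists M => i.
by have := aM i I; rewrite normrZ ger0_norm ?exprn_ge0 ?(ltW r0) // mulrC.
Qed.

(** A radius [r] strictly between [onorm w] and [rho] gives domination by a geometric series of
    ratio [onorm w / r]. *)
Lemma geometric_growth_cvg a w : geometric_growth a -> oball rho w ->
  cvgn (oseries a w).
Proof.
move=> ga /radius_between[r wr rrho].
have r0 : 0 < r := le_lt_trans (onorm_ge0 w) wr.
have [M aM] := ga r r0 rrho.
have ocomplete : geometrically_complete (octonion R).
  by do 3 apply: geometrically_complete_prod; exact: geometrically_complete_real.
apply: (ocomplete _ (3 * M) (onorm w / r)).
- by rewrite divr_ge0 ?onorm_ge0 // ltW.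
- by rewrite ltr_pdivrMr // mul1r.
move=> n; apply: le_trans (norm_le_onorm _) _; rewrite onormM onorm_pow.
rewrite exprMn exprVn mulrCA ler_wpM2l ?exprn_ge0 ?onorm_ge0 //.
rewrite ler_pdivlMr ?exprn_gt0 //; apply: le_trans (_ : 3 * `|a n| * r ^+ n <= _).
  by rewrite ler_wpM2r ?exprn_ge0 ?(ltW r0) // onorm_le_norm.
by rewrite -mulrA ler_wpM2l.
Qed.

Lemma geometric_growth_conj a :
  geometric_growth a -> geometric_growth (fun i => oconj (a i)).
Proof.
move=> ga r r0 /(ga r r0)[M aM]; exists (3 * M) => i.
apply: (@le_trans _ _ (3 * `|a i| * r ^+ i)); last by rewrite -mulrA ler_wpM2l.
rewrite ler_wpM2r ?exprn_ge0 ?(ltW r0) //.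
by apply: le_trans (norm_le_onorm _) _; rewrite onorm_conj onorm_le_norm.
Qed.

(** Bounding [a] at a larger radius [s] gains a factor [(r / s) ^+ i] in each term, so the [k.+1]
    terms add up to a bound independent of [k]. *)
Lemma geometric_growth_conv a b : geometric_growth a -> geometric_growth b ->
  geometric_growth (conv (@omul R) a b).
Proof.
move=> ga gb r r0 rrho; have [s rs srho] := radius_between rrho.
have s0 : 0 < s := lt_trans r0 rs.
have [M aM] := ga s s0 srho; have [N bN] := gb r r0 rrho.
have M0 : 0 <= M by apply: le_trans (aM 0%N); rewrite expr0 mulr1.
have N0 : 0 <= N by apply: le_trans (bN 0%N); rewrite expr0 mulr1.
exists (9 * M * N / (1 - r / s)) => k.
have q0 : 0 <= r / s by rewrite divr_ge0 // ltW.
have q1 : r / s < 1 by rewrite ltr_pdivrMr // mul1r.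
have termle i : (i < k.+1)%N ->
    `|omul (a i) (b (k - i)%N)| * r ^+ k <= 9 * M * N * (r / s) ^+ i.
  (* The 9 comes from two uses of [onorm_le_norm], one per factor. *)
  move=> ik; apply: (@le_trans _ _
      (9 * (`|a i| * r ^+ i) * (`|b (k - i)%N| * r ^+ (k - i)))).
    have -> : r ^+ k = r ^+ i * r ^+ (k - i) by rewrite -exprD subnKC.
    have -> : 9 * (`|a i| * r ^+ i) * (`|b (k - i)%N| * r ^+ (k - i)) =
      (3 * `|a i|) * (3 * `|b (k - i)%N|) * (r ^+ i * r ^+ (k - i)) by ring.
    rewrite ler_wpM2r ?mulr_ge0 ?exprn_ge0 ?(ltW r0) //.
    apply: le_trans (norm_le_onorm _) _.
    by rewrite onormM ler_pM ?onorm_ge0 ?onorm_le_norm.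
  rewrite [leRHS]mulrAC ler_pM ?bN ?mulr_ge0 ?exprn_ge0 ?(ltW r0) //.
  rewrite -mulrA ler_wpM2l // exprMn exprVn mulrA ler_pdivlMr ?exprn_gt0 //.
  by rewrite mulrAC ler_wpM2r ?exprn_ge0 ?(ltW r0).
apply: (@le_trans _ _ (9 * M * N * \sum_(i < k.+1) (r / s) ^+ i)).
  rewrite mulr_sumr; apply: (@le_trans _ _
    ((\sum_(i < k.+1) `|omul (a i) (b (k - i)%N)|) * r ^+ k)).
    by rewrite ler_wpM2r ?exprn_ge0 ?(ltW r0) // ler_norm_sum.
  by rewrite mulr_suml; apply: ler_sum => i _; exact: termle.
rewrite ler_wpM2l ?mulr_ge0 //.
have := geometric_tail_le 0 k.+1 q0 q1.
by rewrite big_mkord expr0 mul1r.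
Qed.

Lemma geometric_growth_expansion a : geometric_growth a ->
  is_expansion rho a (power_sum a).
Proof. by move=> ga w; exact: geometric_growth_cvg. Qed.

(** On a real interval [(0, r)] the difference of the two expansions sums to 0, and the identity
    principle applies. *)
Lemma is_expansion_inj a b f : (0 < rho)%E ->
  is_expansion rho a f -> is_expansion rho b f -> a = b.
Proof.
move=> /radius_between[r r0 rrho] af bf; apply: funext => n.
have [M aM] := is_expansion_growth af r0 rrho.
have [N bN] := is_expansion_growth bf r0 rrho.
apply/eqP; rewrite -subr_eq0; apply/eqP; move: n.
apply: (power_series_eq0 (c := fun i => a i - b i) (M := M + N) r0) => [i|t t0 tr].
  apply: le_trans (lerD (aM i) (bN i)); rewrite -mulrDl.
  by rewrite ler_wpM2r ?exprn_ge0 ?(ltW r0) // ler_normB.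
have tw : oball rho (oreal t).
  rewrite /oball /= onorm_real gtr0_norm //.
  by apply: lt_trans rrho; rewrite lte_fin.
have -> : series (fun i => t ^+ i *: (a i - b i)) =
    oseries a (oreal t) \- oseries b (oreal t).
  rewrite !oseries_real; apply: funext => n.
  by rewrite /series /= -sumrB; apply: eq_bigr => i _; rewrite scalerBr.
rewrite -(subrr (f (oreal t))).
by apply: cvgB; [exact: af|exact: bf].
Qed.

Lemma coefs_expansion f : regular rho f -> is_expansion rho (coefs rho f) f.
Proof. exact: xgetPex. Qed.

(** [coefs] picks some expansion; uniqueness forces it to be [a]. *)
Lemma coefs_power_sum a : (0 < rho)%E -> geometric_growth a ->
  coefs rho (power_sum a) = a.
Proof.
move=> rho0 /geometric_growth_expansion ea.
by apply: (is_expansion_inj rho0 _ ea); apply: coefs_expansion; exists a.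
Qed.

Lemma starE f g a b : coefs rho f = a -> coefs rho g = b ->
  star rho f g = power_sum (conv (@omul R) a b).
Proof. by move=> <- <-. Qed.

Lemma coefs_star f g : (0 < rho)%E ->
  geometric_growth (coefs rho f) -> geometric_growth (coefs rho g) ->
  coefs rho (star rho f g) = conv (@omul R) (coefs rho f) (coefs rho g).
Proof.
by move=> rho0 gf gg; apply: coefs_power_sum rho0 (geometric_growth_conv gf gg).
Qed.

Lemma coefs_conj_series f : (0 < rho)%E -> geometric_growth (coefs rho f) ->
  coefs rho (conj_series rho f) = fun i => oconj (coefs rho f i).
Proof. by move=> rho0 /geometric_growth_conj; exact: coefs_power_sum. Qed.

Definition normal_coefs a : nat -> octonion R :=
  conv (@omul R) a (fun i => oconj (a i)).

Lemma normal_coefs_conv a b :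
  normal_coefs (conv (@omul R) a b) =
  conv (@omul R) (normal_coefs a) (normal_coefs b).
Proof. exact: (@conv_normM R a b). Qed.

Lemma normal_seriesE f : (0 < rho)%E -> geometric_growth (coefs rho f) ->
  normal_series rho f = power_sum (normal_coefs (coefs rho f)).
Proof.
by move=> rho0 gf; rewrite /normal_series /star (coefs_conj_series rho0 gf).
Qed.

Lemma coefs_normal_series f : (0 < rho)%E -> geometric_growth (coefs rho f) ->
  coefs rho (normal_series rho f) = normal_coefs (coefs rho f).
Proof.
move=> rho0 gf; rewrite (normal_seriesE rho0 gf).
have gN := geometric_growth_conv gf (geometric_growth_conj gf).
exact: coefs_power_sum rho0 gN.
Qed.
End RegularFunctions.

Theorem lemma7 (R : realType) (rho : \bar R) (f g : octonion R -> octonion R) :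
  (0 < rho)%E ->
  regular rho f ->
  regular rho g ->
  forall w, oball rho w ->
    normal_series rho (star rho f g) w =
    star rho (normal_series rho f) (normal_series rho g) w.
Proof.
move=> rho0 /coefs_expansion/is_expansion_growth gf.
move=> /coefs_expansion/is_expansion_growth gg w _.
have coefs_fg := coefs_star rho0 gf gg.
(* With this growth bound, both sides become power sums of explicit sequences, equated by
   [normal_coefs_conv]. *)
have gfg : geometric_growth rho (coefs rho (star rho f g)).
  by rewrite coefs_fg; exact: geometric_growth_conv.
rewrite (starE (coefs_normal_series rho0 gf) (coefs_normal_series rho0 gg)).
rewrite (normal_seriesE rho0 gfg) coefs_fg.
by rewrite normal_coefs_conv.
Qed.
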